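(* Fix partitions $\mu,\nu$ and for $k\ge0$ let $\Phi(\mu,\nu,k)$ be the partition with 2-quotient $(\mu,\nu)$ and 2-core $(k,k-1,\dots,1)$. Then $$\lim_{k\to+\infty}\frac{R_{\Phi(\mu,\nu,k)}(2kx)}{(2k)^{|\mu|+|\nu|}}=(x+1)^{|\mu|}(x-1)^{|\nu|}$$ uniformly for $x$ in compact subsets of $\mathbb{C}$, with rate of convergence $O(k^{-1})$.
   Context: Partitions $\lambda=(\lambda_1\ge\dots\ge\lambda_{\ell(\lambda)}>0)$, degree vector $n_i=\lambda_i+\ell(\lambda)-i$, $\Delta(n_\lambda)=\prod_{i<j}(n_j-n_i)$. Hermite: $\mathrm{He}_0=1,\mathrm{He}_1=x,\mathrm{He}_n=x\mathrm{He}_{n-1}-(n-1)\mathrm{He}_{n-2}$; $\mathrm{He}_\lambda=\mathrm{Wr}[\mathrm{He}_{n_1},\dots,\mathrm{He}_{n_{\ell(\lambda)}}]/\Delta(n_\lambda)$. Maya diagram: a set $M\subset\mathbb{Z}$ containing all sufficiently negative integers and finitely many non-negative ones; $\lambda(M)$ has parts the positive values of $\#\{n\notin M:n<m\}$, $m\in M$. $M_\lambda=\{n<0\}\cup\{n_i\}$, $M_\lambda+t=\{m+t:m\in M_\lambda\}$. For partitions $\mu,\nu$ and $k\in\mathbb{Z}$ choose $s,s'\ge0$ with $\ell(\nu)+s'-\ell(\mu)-s=k$ and set $\Phi(\mu,\nu,k)=\lambda(\{2m:m\in M_\mu+s\}\cup\{2m+1:m\in M_\nu+s'\})$; for $k\ge0$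 its 2-quotient is $(\mu,\nu)$ and its 2-core is $\bar\lambda=(k,\dots,1)$. $R_\lambda$ denotes the monic polynomial of degree $|\mu|+|\nu|$ with $\mathrm{He}_\lambda(x)=x^{|\bar\lambda|}R_\lambda(x^2)$. *)

(* Defs.v *)
From HB Require Import structures.
From mathcomp Require Import all_boot all_order all_algebra.
From mathcomp Require Import reals complex.
Set Implicit Arguments. Unset Strict Implicit. Unset Printing Implicit Defensive.
Import Order.TTheory GRing.Theory Num.Theory.
Local Open Scope ring_scope.

Definition is_partition (lam : seq nat) : bool :=
  sorted (fun a b => b <= a)%N lam && all (fun a => 0 < a)%N lam.

Definition psize (lam : seq nat) : nat := sumn lam.

(* degree vector n_i = lambda_i + l(lambda) - i  (i = 1..l), here 0-indexed *)
Definition degvec (lam : seq nat) (i : nat) : nat :=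
  (nth 0 lam i + (size lam - i.+1))%N.

Definition degs (lam : seq nat) : seq nat := [seq degvec lam i | i <- iota 0 (size lam)].

Fixpoint HePair (F : fieldType) (n : nat) : {poly F} * {poly F} :=
  match n with
  | 0 => (1, 'X)
  | m.+1 => let: (a, b) := HePair F m in (b, 'X * b - m.+1%:R *: a)
  end.
Definition He (F : fieldType) (n : nat) : {poly F} := (HePair F n).1.

Definition Wronskian (F : fieldType) (l : nat) (f : nat -> {poly F}) : {poly F} :=
  \det (\matrix_(i < l, j < l) (f j)^`(i)).

Definition Delta (F : fieldType) (lam : seq nat) : F :=
  \prod_(i < size lam) \prod_(j < size lam | (i < j)%N)
     ((degvec lam j)%:R - (degvec lam i)%:R).

Definition HeP (F : fieldType) (lam : seq nat) : {poly F} :=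
  (Delta F lam)^-1 *: Wronskian (size lam) (fun j => He F (degvec lam j)).

(* Maya diagram M_lambda + t, restricted to non-negative integers
   (all negative integers belong to M_lambda + t since t >= 0):
   m \in M_lambda + t  iff  m - t < 0  or  m - t is some n_i. *)
Definition inMaya (lam : seq nat) (t m : nat) : bool :=
  (m < t)%N || ((m - t)%N \in degs lam).

(* Phi(mu,nu,k) with the choice s = l(nu), s' = l(mu) + k
   (so that l(nu) + s' - l(mu) - s = k).  M is the combined Maya diagram
   {2m : m in M_mu + s} u {2m+1 : m in M_nu + s'}; on negative integers
   it is full, so we only record its non-negative part. *)
Definition PhiMaya (mu nu : seq nat) (k : nat) (n : nat) : bool :=
  if odd n then inMaya nu (size mu + k) n./2 else inMaya mu (size nu) n./2.

(* An upper bound beyond which PhiMaya is empty. *)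
Definition PhiBound (mu nu : seq nat) (k : nat) : nat :=
  (2 * (psize mu + psize nu + size mu + size nu + size mu + k + size nu + 1)).+1.

(* lambda(M): the positive values of #{n notin M : n < m}, m in M, sorted
   decreasingly.  Negative n are all in M, so the count runs over [0, m);
   elements m < 0 of M contribute 0 and are discarded. *)
Definition Phi (mu nu : seq nat) (k : nat) : seq nat :=
  let M := PhiMaya mu nu k in
  sort (fun a b => b <= a)%N
    [seq c <- [seq count (fun j => ~~ M j) (iota 0 m) | m <- iota 0 (PhiBound mu nu k) & M m]
     | (0 < c)%N].

(* R_lambda for a partition lambda with 2-core of size c:
   He_lambda(x) = x^c R_lambda(x^2), i.e. the coefficients of R_lambda are the
   coefficients of He_lambda in degrees c, c+2, c+4, ... *)
Definition Rpoly (F : fieldType) (lam : seq nat) (c : nat) : {poly F} :=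
  \poly_(i < size (HeP F lam)) (HeP F lam)`_(c + 2 * i).

(* R_{Phi(mu,nu,k)}: the 2-core (k,...,1) has size k(k+1)/2 = 'C(k+1,2). *)
Definition RPhi (F : fieldType) (mu nu : seq nat) (k : nat) : {poly F} :=
  Rpoly F (Phi mu nu k) 'C(k.+1, 2).

(* Main.v *)
Require Import Defs.
From HB Require Import structures.
From mathcomp Require Import all_boot all_order all_algebra all_fingroup.
From mathcomp Require Import ring lra zify.
From mathcomp Require Import reals complex.
Import Order.TTheory GRing.Theory Num.Theory.
Local Open Scope ring_scope.

(** Since [He_n] satisfies [x He_n' = n He_n + n (n-1) He_(n-2)], applying the
    Euler operator column by column to [W(n) = Wr[He_(n_1), .., He_(n_l)]] gives
      [x W' - (|n| - C(l,2)) W = sum_j n_j (n_j - 1) W(n - 2 e_j)].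
    Lowering a degree by 2 removes a domino from the partition, that is, one box
    from [mu] or from [nu], and leaves the 2-core unchanged. Comparing coefficients,
    the rescaled coefficients [g_i] of [R_Phi(mu,nu,k)] satisfy
      [(i - |mu| - |nu|) g_i = sum w g_i'],
    the sum being over all ways to remove a box. The weights [w] converge at rate
    [O(1/k)], because their growing products over the run of odd degrees
    1, 3, .., 2m-1 telescope, and the limits add up to [-|mu|] over [mu] and to
    [|nu|] over [nu]. This is the recursion of the coefficients of
    [(x+1)^|mu| (x-1)^|nu|], and the leading coefficients agree, so induction on
    [|mu| + |nu|] concludes. *)

Set Implicit Arguments. Unset Strict Implicit. Unset Printing Implicit Defensive.

(** * Alternants *)

(** One format for Wronskians ([phi i n] the [i]-th derivative of [He_n]) and Vandermonde products
    ([phi i n] the falling factorial), so that both obey the same lemmas. *)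
Definition altmx (A : comNzRingType) (phi : nat -> nat -> A) (s : seq nat) :
    'M[A]_(size s) :=
  \matrix_(i, j) phi i (nth 0%N s j).

Definition altdet (A : comNzRingType) (phi : nat -> nat -> A) (s : seq nat) : A :=
  \det (altmx phi s).

Section Alternants.
Variable A : comNzRingType.
Implicit Types (phi : nat -> nat -> A) (s : seq nat).

Lemma altdet_size phi s l : size s = l ->
  altdet phi s = \det (\matrix_(i < l, j < l) phi i (nth 0%N s j)).
Proof. by move=> <-. Qed.

Lemma altdet_nuniq phi s : ~~ uniq s -> altdet phi s = 0.
Proof.
move=> /(uniqPn 0%N) [i [j [ij js e]]].
rewrite /altdet -det_tr.
have li := ltn_trans ij js.
apply: (@determinant_alternate _ _ _ (Ordinal li) (Ordinal js)).
  by rewrite -val_eqE /= ltn_eqF.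
by move=> k; rewrite !mxE /= e.
Qed.

Lemma altdet_set_nth phi s j n : (j < size s)%N ->
  altdet phi (set_nth 0%N s j n) =
  \det (\matrix_(i < size s, k < size s)
          phi i (if k == j :> nat then n else nth 0%N s k)).
Proof.
move=> js; rewrite (@altdet_size _ _ (size s)).
  by congr (\det _); apply/matrixP=> i k; rewrite !mxE nth_set_nth.
by rewrite size_set_nth; apply/maxn_idPr.
Qed.

(* Replacing one argument v by g v in an alternant changes one column; its
   expansion along that column brings in the cofactors of the original matrix. *)
Lemma sum_altdet_set_nth phi s (c : nat -> A) (g : nat -> nat) (D : nat -> nat -> A) :
  (forall i n, c n * phi i (g n) = D i n) ->
  \sum_(j < size s)
     c (nth 0%N s j) * altdet phi (set_nth 0%N s j (g (nth 0%N s j))) =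
  \sum_(j < size s) \sum_(i < size s)
     D i (nth 0%N s j) * cofactor (altmx phi s) i j.
Proof.
move=> cD; apply: eq_bigr => j _.
rewrite altdet_set_nth // (expand_det_col _ j) mulr_sumr.
apply: eq_bigr => i _; rewrite mxE eqxx mulrA cD; congr (_ * _).
rewrite /cofactor; congr (_ * \det _); apply/matrixP=> a b; rewrite !mxE.
by rewrite -[_ == _ :> nat]/(lift j b == j) eq_sym (negbTE (neq_lift _ _)).
Qed.

(** A column weight factors out of the expansion along its column, a row weight out of the expansion
    along its row. *)
Lemma sum_weight_cofactor l (M : 'M[A]_l) (c u : 'I_l -> A) :
  \sum_j \sum_i (c j - u i) * M i j * cofactor M i j =
  (\sum_j c j - \sum_i u i) * \det M.
Proof.
have h j i : (c j - u i) * M i j * cofactor M i j =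
  c j * (M i j * cofactor M i j) - u i * (M i j * cofactor M i j) by ring.
rewrite mulrBl; transitivity (\sum_j \sum_i c j * (M i j * cofactor M i j) -
  \sum_j \sum_i u i * (M i j * cofactor M i j)).
  rewrite -sumrB; apply: eq_bigr => j _; rewrite -sumrB.
  by apply: eq_bigr => i _.
congr (_ - _); last rewrite exchange_big; rewrite /= mulr_suml; apply: eq_bigr => i _.
  by rewrite -mulr_sumr -expand_det_col.
by rewrite -mulr_sumr -expand_det_row.
Qed.

End Alternants.

(** The sign is chosen before the ring and [phi], so it is the same for a Wronskian and its
    Vandermonde denominator and cancels in the quotient. *)
Lemma altdet_perm (s t : seq nat) : perm_eq s t ->
  exists b : bool, forall (A : comNzRingType) (phi : nat -> nat -> A),
    altdet phi s = (-1) ^+ b * altdet phi t.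
Proof.
move=> st; have sz := perm_size st.
have /tuple_permP[p sp] : perm_eq s (in_tuple t) by [].
exists (odd_perm p) => A phi.
rewrite (altdet_size _ sz).
have -> : (\matrix_(i < size t, j < size t) phi i (nth 0%N s j)) =
   col_perm p (altmx phi t).
  apply/matrixP=> i j; rewrite !mxE sp.
  by rewrite -tnth_nth tnth_mktuple (tnth_nth 0%N).
by rewrite col_permE det_mulmx det_perm odd_permV mulrC.
Qed.

(** Differentiate one row at a time by the product rule, then expand each resulting determinant
    along that row. *)
Lemma deriv_det (R : comNzRingType) l (M : 'M[{poly R}]_l) :
  (\det M)^`() = \sum_j \sum_i (M i j)^`() * cofactor M i j.
Proof.
have dprod (I : finType) (f : I -> {poly R}) :
    (\prod_i f i)^`() = \sum_i \prod_j (if j == i then (f j)^`() else f j).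
  have gen (r : seq I) : uniq r -> (\prod_(i <- r) f i)^`() =
      \sum_(i <- r) \prod_(j <- r) (if j == i then (f j)^`() else f j).
    elim: r => [|x r IH] /=; first by rewrite !big_nil derivC.
    move=> /andP[xr ur]; rewrite !big_cons derivM IH // eqxx; congr (_ * _ + _).
      by apply: eq_big_seq => j jr; case: eqP => // e; rewrite -e jr in xr.
    rewrite mulr_sumr; apply: eq_big_seq => j jr; rewrite big_cons.
    by case: eqP => // e; rewrite e jr in xr.
  by apply: gen; apply: index_enum_uniq.
rewrite exchange_big /=.
transitivity (\sum_i \det (\matrix_(a, b) if a == i then (M a b)^`() else M a b)).
  rewrite /determinant raddf_sum exchange_big /=; apply: eq_bigr => s _.
  rewrite derivM -mulr_sumr.
  have -> : ((-1) ^+ s : {poly R})^`() = 0.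
    by case: (odd_perm s); rewrite ?expr1 ?expr0 ?derivN ?derivC ?oppr0.
  rewrite mul0r add0r dprod; congr (_ * _); apply: eq_bigr => i _.
  by apply: eq_bigr => j _; rewrite mxE.
apply: eq_bigr => i _; rewrite (expand_det_row _ i); apply: eq_bigr => j _.
rewrite mxE eqxx; congr (_ * _); rewrite /cofactor; congr (_ * \det _).
by apply/matrixP=> a b; rewrite !mxE eq_sym (negbTE (neq_lift _ _)).
Qed.

(** * Hermite polynomials and Vandermonde products *)

Section HermitePolynomials.
Variable F : fieldType.

Lemma HeSS n : He F n.+2 = 'X * He F n.+1 - n.+1%:R *: He F n.
Proof. by rewrite /He /=; case: (HePair F n) => a b. Qed.

Lemma mulX_He n : 'X * He F n = He F n.+1 + n%:R *: He F n.-1.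
Proof.
case: n => [|n]; first by rewrite scale0r addr0 [He F 0]/He /= mulr1.
by rewrite HeSS subrK.
Qed.

Lemma deriv_He n : (He F n)^`() = n%:R *: He F n.-1.
Proof.
suff: (He F n)^`() = n%:R *: He F n.-1 /\ (He F n.+1)^`() = n.+1%:R *: He F n by case.
elim: n => [|n [IH IHS]].
  by rewrite scale0r scale1r [He F 0]/He [He F 1]/He /= derivX derivC.
split=> //; rewrite HeSS derivB derivM derivX derivZ IHS IH mul1r.
have -> : He F n.+1 = 'X * He F n - n%:R *: He F n.-1.
  by rewrite mulX_He addrK.
rewrite -!mul_polyC -!natr1 !polyCD polyC1.
ring.
Qed.

Lemma euler_He n :
  'X * (He F n)^`() = n%:R *: He F n + (n * n.-1)%:R *: He F n.-2.
Proof.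
rewrite deriv_He -scalerAr mulX_He; case: n => [|n]; first by rewrite !scale0r addr0.
by rewrite scalerDr scalerA natrM.
Qed.

(** Commuting ['X] past [i] derivatives costs [i] times the [i]-th derivative; over the rows of a
    Wronskian these costs add up to [C(l,2)]. *)
Lemma mulX_derivnS (p : {poly F}) i :
  'X * p^`(i.+1) = ('X * p^`())^`(i) - i%:R *: p^`(i).
Proof.
elim: i => [|i IH]; first by rewrite scale0r subr0.
rewrite [in RHS]derivnS -[X in X^`() - _](subrK (i%:R *: p^`(i))) -IH.
rewrite derivD derivM derivX -!derivnS derivZ -derivnS mul1r.
rewrite -natr1 scalerDl scale1r; ring.
Qed.

Lemma size_He n : size (He F n) = n.+1.
Proof.
suff: size (He F n) = n.+1 /\ size (He F n.+1) = n.+2 by case.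
elim: n => [|n [IH IHS]].
  by rewrite [He F 0]/He [He F 1]/He /= size_poly1 size_polyX.
split=> //; rewrite HeSS size_polyDl mulrC size_mulX -?size_poly_gt0 IHS //.
by rewrite size_polyN (leq_ltn_trans (size_scale_leq _ _)) // IH.
Qed.

Lemma lead_coef_He n : (He F n)`_n = 1.
Proof.
elim: n => [|n IH]; first by rewrite [He F 0]/He coef1.
case: n IH => [|n] IH; first by rewrite [He F 1]/He /= coefX.
rewrite HeSS coefB coefXM coefZ /= IH nth_default ?mulr0 ?subr0 //.
by rewrite size_He.
Qed.

End HermitePolynomials.

Fixpoint vdm (F : comNzRingType) (s : seq nat) : F :=
  if s is x :: s' then \prod_(u <- s') (u%:R - x%:R) * vdm F s' else 1.

Section VandermondeSeq.

Lemma vdm_prodE (F : comNzRingType) s :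
  \prod_(i < size s) \prod_(j < size s | (i < j)%N)
    ((nth 0%N s j)%:R - (nth 0%N s i)%:R) = vdm F s.
Proof.
elim: s => [|x s IH]; first by rewrite big_ord0.
rewrite big_ord_recl /= -IH (big_nth 0%N) big_mkord; congr (_ * _).
  by rewrite big_mkcond big_ord_recl /= mul1r.
apply: eq_bigr => i _; rewrite big_mkcond big_ord_recl /= mul1r [RHS]big_mkcond.
by apply: eq_bigr => j _.
Qed.

Lemma vdm_cat_cons (F : comNzRingType) s x t :
  vdm F (s ++ x :: t) = (-1) ^+ size s * vdm F (x :: s ++ t).
Proof.
elim: s => [|y s IH] /=; first by rewrite mul1r.
rewrite IH /= !(big_cons, big_cat) /= exprS; ring.
Qed.

Lemma ffact_horner (F : comNzRingType) i n :
  (\prod_(t < i) ('X - t%:R%:P)).[n%:R] = (n ^_ i)%:R :> F.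
Proof.
elim: i => [|i IH]; first by rewrite big_ord0 hornerE.
rewrite big_ord_recr /= hornerM IH !hornerE ffactnSr natrM.
case: (leqP i n) => h; first by rewrite natrB.
by rewrite ffact_small // !mul0r.
Qed.

(** Falling factorials are monic in [n], so a unitriangular change of basis leads to the Vandermonde
    matrix. *)
Lemma altdet_ffact (F : comNzRingType) s :
  altdet (fun i n => (n ^_ i)%:R : F) s = vdm F s.
Proof.
rewrite -vdm_prodE /altdet.
pose T : 'M[F]_(size s) := \matrix_(i, k) (\prod_(t < i) ('X - t%:R%:P : {poly F}))`_k.
have sT (i : nat) : size (\prod_(t < i) ('X - t%:R%:P : {poly F})) = i.+1.
  by rewrite size_prod_XsubC -[index_enum _]enumT size_enum_ord.
have -> : altmx (fun i n => (n ^_ i)%:R : F) s =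
   T *m Vandermonde (size s) (\row_j (nth 0%N s j)%:R).
  apply/matrixP=> i j; rewrite !mxE -ffact_horner (@horner_coef_wide _ (size s)) ?sT //.
  by apply: eq_bigr => k _; rewrite !mxE.
have detT : \det T = 1.
  rewrite det_trig; last first.
    by apply/is_trig_mxP => i j ij; rewrite !mxE nth_default // sT.
  apply: big1 => i _; rewrite mxE.
  have /monicP := monic_prod_XsubC (index_enum 'I_i) xpredT (fun t : 'I_i => t%:R : F).
  by rewrite /lead_coef sT.
rewrite det_mulmx detT mul1r det_Vandermonde.
by apply: eq_bigr => i _; apply: eq_bigr => j _; rewrite !mxE.
Qed.

Variable F : numFieldType.

Lemma vdm_eq0 s : (vdm F s == 0) = ~~ uniq s.
Proof.
elim: s => [|x s IH] /=; first by rewrite oner_eq0.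
rewrite mulf_eq0 IH negb_and negbK; congr (_ || _).
rewrite prodf_seq_eq0; apply/hasP/idP => [[u us]|xs].
  by rewrite /= subr_eq0 eqr_nat => /eqP <-.
by exists x => //=; rewrite subrr.
Qed.

(** Move entry [j] to the front on both sides: the signs agree, and only the factors involving this
    entry change. *)
Lemma vdm_set_nth s j y : uniq s -> (j < size s)%N ->
  let v := nth 0%N s j in
  vdm F (set_nth 0%N s j y) =
  vdm F s * \prod_(u <- rem v s) ((y%:R - u%:R) / (v%:R - u%:R)).
Proof.
move=> us js v; rewrite set_nthE js vdm_cat_cons.
have sE : s = take j s ++ v :: drop j.+1 s by rewrite -drop_nth ?cat_take_drop.
have remE : rem v s = take j s ++ drop j.+1 s by rewrite remE index_uniq.
have vr : v \notin rem v s by rewrite mem_rem_uniqF.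
have -> : vdm F s = (-1) ^+ size (take j s) * vdm F (v :: rem v s).
  by rewrite {1}sE vdm_cat_cons -remE.
rewrite /= -remE -!mulrA; congr (_ * _); rewrite mulrCA mulrC; congr (_ * _).
rewrite -big_split /=.
apply: eq_big_seq => u ur.
have h : v%:R - u%:R != 0 :> F.
  by rewrite subr_eq0 eqr_nat; apply: contra vr => /eqP {1}->.
by rewrite -[u%:R - v%:R]opprB mulNr mulrC divfK // opprB.
Qed.

Lemma sum_nth (G : nat -> F) s : \sum_(v <- s) G v = \sum_(j < size s) G (nth 0%N s j).
Proof. by rewrite (big_nth 0%N) big_mkord. Qed.

(** Analogue of the Euler identity for falling factorials, in which [n] times the [i]-th falling
    factorial of [n-1] is [n-i] times that of [n]. It is the branching rule for numbers of standard
    tableaux, and it evaluates the total of the limit weights. *)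
Lemma sum_lower_ratio s : uniq s ->
  \sum_(x <- s) (x%:R * \prod_(u <- rem x s) ((x%:R - 1 - u%:R) / (x%:R - u%:R))) =
  (sumn s)%:R - 'C(size s, 2)%:R :> F.
Proof.
move=> us; have V0 : vdm F s != 0 by rewrite vdm_eq0 us.
apply: (mulIf V0); rewrite -{2}altdet_ffact.
have -> : (sumn s)%:R = \sum_(j < size s) (nth 0%N s j)%:R :> F.
  by rewrite sumnE natr_sum sum_nth.
have -> : 'C(size s, 2)%:R = \sum_(i < size s) i%:R :> F.
  by rewrite -bin2_sum natr_sum big_mkord.
rewrite -sum_weight_cofactor.
under [RHS]eq_bigr => j _ do under eq_bigr => i _ do rewrite [altmx _ _ i j]mxE.
have := @sum_altdet_set_nth _ (fun i n => (n ^_ i)%:R : F) s (fun n => n%:R) predn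
  (fun i n => (n%:R - i%:R) * (n ^_ i)%:R).
move=> <-; last first.
  move=> i n; rewrite -natrM -ffactnS ffactnSr natrM mulrC.
  case: (leqP i n) => h; first by rewrite natrB.
  by rewrite ffact_small // !mulr0.
rewrite sum_nth mulr_suml; apply: eq_bigr => j _.
rewrite altdet_ffact vdm_set_nth // [vdm F s * _]mulrC mulrA; congr (_ * _).
(* [predn] truncates at 0, where the factor in front vanishes. *)
case: (nth 0%N s j) => [|v]; first by rewrite !mul0r.
by rewrite -natr1 addrK.
Qed.

End VandermondeSeq.

(** * Wronskians of Hermite polynomials *)

Section HermiteWronskians.
Variable F : numFieldType.
Implicit Types s t : seq nat.

Definition heW s : {poly F} := altdet (fun i n => (He F n)^`(i)) s.
(** Makes sense for every sequence of degrees; a repeated degree, as after an impossible removal,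
    gives 0. *)
Definition heS s : {poly F} := (vdm F s)^-1 *: heW s.

Lemma heW_vdm s : heW s = vdm F s *: heS s.
Proof.
rewrite /heS scalerA; case: (boolP (uniq s)) => us.
  by rewrite mulfV ?scale1r // vdm_eq0 us.
by rewrite /heW altdet_nuniq // scaler0.
Qed.

Lemma HeP_heS lam : HeP F lam = heS (degs lam).
Proof.
have sz : size (degs lam) = size lam by rewrite size_map size_iota.
have nthd j : (j < size lam)%N -> nth 0%N (degs lam) j = degvec lam j.
  by move=> jl; rewrite (nth_map 0%N) ?size_iota // nth_iota.
rewrite /HeP /heS -vdm_prodE /Delta sz; congr (_^-1 *: _).
  by apply: eq_bigr => i _; apply: eq_bigr => j _; rewrite !nthd.
rewrite /heW (altdet_size _ sz); congr (\det _); apply/matrixP => i j.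
by rewrite !mxE nthd.
Qed.

Lemma heS_perm s t : perm_eq s t -> heS s = heS t.
Proof.
move=> /altdet_perm [b st]; rewrite /heS /heW -!altdet_ffact !st.
have -> : (-1) ^+ b = ((-1) ^+ b)%:P :> {poly F} by case: b {st}; rewrite ?polyCN.
rewrite mul_polyC scalerA; congr (_ *: _); rewrite invfM mulrAC.
by case: b {st}; rewrite ?invr1 ?mul1r // invrN1 mulrNN !mul1r.
Qed.

Lemma altdet_cons0 (A : comNzRingType) (phi : nat -> nat -> A) (c : nat -> A) s :
  phi 0 0 = 1 -> (forall i, phi i.+1 0 = 0) ->
  (forall i n, phi i.+1 n.+1 = c n * phi i n) ->
  altdet phi (0%N :: map S s) = \prod_(u <- s) c u * altdet phi s.
Proof.
move=> h0 hS hSS; have sz : size (0%N :: map S s) = (size s).+1 by rewrite /= size_map.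
rewrite (altdet_size _ sz) (expand_det_col _ ord0) big_ord_recl mxE /= h0 mul1r.
rewrite big1 ?addr0; last by move=> i _; rewrite mxE /= hS mul0r.
rewrite /cofactor /= expr0 mul1r (big_nth 0%N) big_mkord.
pose d := \row_(j < size s) c (nth 0%N s j).
have -> : \prod_(j < size s) c (nth 0%N s j) = \det (diag_mx d).
  by rewrite det_diag; apply: eq_bigr => j _; rewrite mxE.
rewrite /altdet mulrC -det_mulmx mul_mx_diag; congr (\det _).
by apply/matrixP=> i j; rewrite !mxE !lift0 /= (nth_map 0%N) // hSS mulrC.
Qed.

(** Both sequences are beta-sets of one partition. As [He_(n+1)' = (n+1) He_n], numerator and
    denominator both gain the product of all [u+1]. *)
Lemma heS_cons0 s : heS (0%N :: map S s) = heS s.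
Proof.
pose c u : F := u.+1%:R.
have c0 : \prod_(u <- s) c u != 0.
  by rewrite prodf_seq_neq0; apply/allP => u _ /=; rewrite pnatr_eq0.
rewrite /heS /heW -!altdet_ffact.
rewrite (@altdet_cons0 _ _ c); first last.
- by move=> i n; rewrite ffactSS natrM.
- by move=> i; rewrite ffact_small.
- by [].
rewrite (@altdet_cons0 _ _ (fun u => (c u)%:P)); first last.
- by move=> i n; rewrite derivSn deriv_He derivnZ mul_polyC.
- by move=> i; rewrite derivSn deriv_He scale0r linear0.
- by [].
have -> : \prod_(u <- s) (c u)%:P = (\prod_(u <- s) c u)%:P by rewrite rmorph_prod.
rewrite mul_polyC scalerA invfM mulrAC mulVf ?mul1r //.
Qed.

Lemma heS_iota_cat m s : heS (iota 0 m ++ map (addn m) s) = heS s.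
Proof.
elim: m => [|m IH]; first by rewrite /= (eq_map (g := id)) ?map_id.
rewrite -[RHS]IH -[RHS]heS_cons0 map_cat -map_comp; congr (heS (0%N :: _ ++ _)).
exact: (iotaDl 1 0).
Qed.

(** Entrywise, ['X] times the derivative, minus [n - i] times the entry in row [i], is [n (n-1)]
    times the entry for degree [n-2]. The weights [n - i] add up to the scalar on the left; ratios
    of Vandermonde products renormalise the terms. *)
Lemma euler_heS s : uniq s ->
  'X * (heS s)^`() - ((sumn s)%:R - 'C(size s, 2)%:R) *: heS s =
  \sum_(v <- s) ((v * v.-1)%:R *
     \prod_(u <- rem v s) ((v%:R - 2 - u%:R) / (v%:R - u%:R))) *: heS (v.-2 :: rem v s).
Proof.
move=> us; have V0 : vdm F s != 0 by rewrite vdm_eq0 us.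
apply: (scalerI V0); rewrite scalerBr scalerAr -derivZ.
rewrite [_ *: (_ *: heS s)]scalerA [_ * (_ - _)]mulrC -scalerA -heW_vdm.
have -> : (sumn s)%:R = \sum_(j < size s) (nth 0%N s j)%:R :> F.
  by rewrite sumnE natr_sum (big_nth 0%N) big_mkord.
have -> : 'C(size s, 2)%:R = \sum_(i < size s) i%:R :> F.
  by rewrite -bin2_sum natr_sum big_mkord.
have -> : (\sum_(j < size s) (nth 0%N s j)%:R - \sum_(i < size s) i%:R) *: heW s =
  (\sum_(j < size s) (nth 0%N s j)%:R%:P - \sum_(i < size s) i%:R%:P) * heW s.
  by rewrite -!raddf_sum -mul_polyC -polyCB.
rewrite /heW deriv_det -sum_weight_cofactor mulr_sumr -sumrB.
under eq_bigr => j _.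
  rewrite mulr_sumr -sumrB.
  under eq_bigr => i _ do rewrite [altmx _ _ i j]mxE mulrA -mulrBl.
  over.
have /= <- := @sum_altdet_set_nth _ (fun i n => (He F n)^`(i)) s
  (fun n => (n * n.-1)%:R%:P) (fun n => n.-2)
  (fun i n => 'X * (He F n)^`(i)^`() - (n%:R%:P - i%:R%:P) * (He F n)^`(i)); last first.
  move=> i n; rewrite -derivnS mulX_derivnS euler_He derivnD !derivnZ -!mul_polyC.
  ring.
rewrite (big_nth 0%N) big_mkord scaler_sumr; apply: eq_bigr => j _.
rewrite mul_polyC -/(heW _) heW_vdm vdm_set_nth //.
set v := nth 0%N s j.
have -> : heS (set_nth 0%N s j v.-2) = heS (v.-2 :: rem v s).
  apply: heS_perm; rewrite set_nthE ltn_ord remE index_uniq //.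
  by rewrite perm_catC /= perm_cons perm_catC.
move: (heS _) => h; rewrite !scalerA mulrCA; congr ((_ * _) *: _).
(* For [v <= 1] the subtraction in [v.-2] truncates, but [v (v-1)] is zero. *)
case: (ltnP 1 v) => hv; last by case: v hv => [|[|]]; rewrite ?mul0n ?muln0 ?mul0r.
by rewrite -subn2 natrB.
Qed.

(** Coefficient and degree bound are proved together: the bound discards all other products of
    coefficients in the induction. *)
Lemma coef_prod_top (I : eqType) (r : seq I) (p : I -> {poly F}) (e : I -> nat) :
  (forall i, (size (p i) <= (e i).+1)%N) ->
  (\prod_(i <- r) p i)`_(\sum_(i <- r) e i) = \prod_(i <- r) (p i)`_(e i) /\
  (size (\prod_(i <- r) p i)%R <= (\sum_(i <- r) e i).+1)%N.
Proof.
move=> h; elim: r => [|x r [IH IHs]]; first by rewrite !big_nil coef1 size_poly1.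
rewrite !big_cons; split; last first.
  apply: leq_trans (size_polyMleq _ _) _.
  by move: (h x) IHs; lia.
have hx : (e x < (e x + \sum_(j <- r) e j).+1)%N by lia.
rewrite coefM (bigD1 (Ordinal hx)) //= addKn IH [X in _ + X]big1 ?addr0 // => -[j /= jl].
rewrite -val_eqE /= => jx; case: (ltnP (e x) j) => h1.
  by rewrite [(p x)`_j]nth_default ?mul0r // (leq_trans (h x)).
rewrite [X in _ * X]nth_default ?mulr0 // (leq_trans IHs) //; lia.
Qed.

(** In each Leibniz term the entry in row [i] has degree at most [n - i], with top coefficient the
    falling factorial; the coefficients in degree [D] thus form the falling-factorial alternant. *)
Lemma heW_top s D : (D + 'C(size s, 2) = sumn s)%N ->
  (heW s)`_D = vdm F s /\ (size (heW s) <= D.+1)%N.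
Proof.
move=> hD; rewrite -altdet_ffact /heW /altdet.
pose M := altmx (fun i n => (He F n)^`(i)) s.
have term (sg : {perm 'I_(size s)}) :
    (\prod_i M i (sg i))`_D = \prod_i altmx (fun i n => (n ^_ i)%:R : F) s i (sg i) /\
    (size (\prod_i M i (sg i))%R <= D.+1)%N.
  (* A row index exceeding the degree makes the term zero on both sides. *)
  case: (pickP (fun i : 'I_(size s) => (nth 0%N s (sg i) < i)%N)) => [i hi|hi].
    rewrite [\prod_i altmx _ _ _ _](bigD1 i) //= [altmx _ s i (sg i)]mxE ffact_small // mul0r.
    rewrite (bigD1 i) //= [M i (sg i)]mxE derivn_poly0 ?size_He // mul0r coef0.
    by rewrite size_poly0.
  under [\prod_i altmx _ _ _ _]eq_bigr => i _ do rewrite mxE.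
  have -> : D = (\sum_(i < size s) (nth 0%N s (sg i) - i))%N.
    apply/eqP; rewrite -(eqn_add2r 'C(size s, 2)) hD -bin2_sum big_mkord -big_split /=.
    rewrite sumnE (big_nth 0%N) big_mkord (reindex_inj (@perm_inj _ sg)) /=.
    by apply/eqP/eq_bigr => i _; rewrite subnK // leqNgt hi.
  have szd i : (size (M i (sg i)) <= (nth 0%N s (sg i) - i).+1)%N.
    rewrite mxE; apply/leq_sizeP => j hj; rewrite coef_derivn nth_default ?mul0rn //.
    rewrite size_He; have := hi i; lia.
  have [-> ?] := coef_prod_top (index_enum _) szd; split=> //.
  apply: eq_bigr => i _; rewrite mxE coef_derivn subnKC; last by rewrite leqNgt hi.
  by rewrite lead_coef_He.
have sgE (sg : {perm 'I_(size s)}) : (-1) ^+ sg = ((-1) ^+ sg)%:P :> {poly F}.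
  by case: (odd_perm sg); rewrite ?polyCN.
rewrite /determinant; split.
  rewrite coef_sum; apply: eq_bigr => sg _.
  by rewrite sgE coefCM; congr (_ * _); have [-> _] := term sg.
apply/leq_sizeP => j hj; rewrite coef_sum big1 // => sg _.
by rewrite sgE coefCM nth_default ?mulr0 //; have [_ /leq_trans] := term sg; apply.
Qed.

Lemma heS_lead s D : uniq s -> (D + 'C(size s, 2) = sumn s)%N -> (heS s)`_D = 1.
Proof.
by move=> us /heW_top [h _]; rewrite coefZ h mulVf // vdm_eq0 us.
Qed.

Lemma size_heS s D : (D + 'C(size s, 2) = sumn s)%N -> (size (heS s) <= D.+1)%N.
Proof. by move=> /heW_top [_]; apply: leq_trans (size_scale_leq _ _). Qed.

End HermiteWronskians.

(** * Interlaced degree sequences *)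

(** Beta-set with even runner [a] and odd runner [b] shifted by [m]. The full initial run of the odd
    runner is kept apart because its factors telescope. *)
Definition interlace (a b : seq nat) (m : nat) : seq nat :=
  [seq (2 * x)%N | x <- a] ++
  ([seq (2 * (y + m)).+1 | y <- b] ++ [seq (2 * t).+1 | t <- iota 0 m]).

(** Removal of a box from the partition with beta-set [a]. For [x > 0] with [x-1] already in [a] no
    box can be removed, and the result has a repetition. *)
Definition lower (x : nat) (a : seq nat) : seq nat := x.-1 :: rem x a.

Section Interlace.
Implicit Types a b : seq nat.

Lemma uniq_interlace a b m : uniq a -> uniq b -> uniq (interlace a b m).
Proof.
move=> ua ub; rewrite !cat_uniq !map_inj_uniq ?iota_uniq ?ua ?ub //=;
  try by move=> i j /=; lia.
rewrite andbT; apply/andP; split; apply/hasPn => v.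
  rewrite mem_cat => /orP[] /mapP[i _ ->]; apply/mapP => -[j _]; lia.
case/mapP => i; rewrite mem_iota => hi ->; apply/mapP => -[j _]; lia.
Qed.

Lemma perm_interlace a a' b b' m :
  perm_eq a a' -> perm_eq b b' -> perm_eq (interlace a b m) (interlace a' b' m).
Proof. by move=> pa pb; rewrite perm_cat ?perm_map // perm_cat ?perm_map. Qed.

Lemma interlace_consl x a b m :
  interlace (x :: a) b m = (2 * x)%N :: interlace a b m.
Proof. by []. Qed.

Lemma interlace_consr y a b m :
  perm_eq (interlace a (y :: b) m) ((2 * (y + m)).+1 :: interlace a b m).
Proof. by rewrite /interlace /= perm_catC /= perm_cons perm_catC. Qed.

Lemma mem_interlacel x a b m : x \in a -> (2 * x)%N \in interlace a b m.
Proof. by move=> xa; rewrite mem_cat map_f. Qed.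

Lemma mem_interlacer y a b m : y \in b -> (2 * (y + m)).+1 \in interlace a b m.
Proof.
move=> yb; rewrite !mem_cat; apply/orP; right; apply/orP; left.
exact: (map_f (fun y => (2 * (y + m)).+1)).
Qed.

Lemma rem_interlacel x a b m : x \in a ->
  perm_eq (rem (2 * x)%N (interlace a b m)) (interlace (rem x a) b m).
Proof.
move=> xa; rewrite -(perm_cons (2 * x)%N) -interlace_consl.
rewrite -(permPl (perm_to_rem (mem_interlacel b m xa))).
by apply: perm_interlace => //; apply: perm_to_rem.
Qed.

Lemma rem_interlacer y a b m : y \in b ->
  perm_eq (rem (2 * (y + m)).+1 (interlace a b m)) (interlace a (rem y b) m).
Proof.
move=> yb; rewrite -(perm_cons (2 * (y + m)).+1).
rewrite -(permPr (interlace_consr _ _ _ _)).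
rewrite -(permPl (perm_to_rem (mem_interlacer a m yb))).
by apply: perm_interlace => //; apply: perm_to_rem.
Qed.

Lemma sumn_lower x a : x \in a -> (0 < x)%N -> (sumn (lower x a)).+1 = sumn a.
Proof. by move=> xa x0; rewrite (perm_sumn (perm_to_rem xa)) /=; lia. Qed.

Lemma size_lower x a : x \in a -> size (lower x a) = size a.
Proof. by move=> xa; rewrite (perm_size (perm_to_rem xa)). Qed.

Lemma sumn_interlace a b m :
  sumn (interlace a b m) = (2 * sumn a + 2 * sumn b + size b * (2 * m).+1 + m ^ 2)%N.
Proof.
rewrite !sumn_cat; have -> : sumn [seq (2 * t).+1 | t <- iota 0 m] = (m ^ 2)%N.
  elim: m => // m IH; rewrite -[m.+1]addn1 iotaD map_cat sumn_cat IH /= add0n; nia.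
have -> : sumn [seq (2 * x)%N | x <- a] = (2 * sumn a)%N.
  by elim: a => //= x a ->; lia.
have -> : sumn [seq (2 * (y + m)).+1 | y <- b] = (2 * sumn b + size b * (2 * m).+1)%N.
  by elim: b => //= x b ->; lia.
by lia.
Qed.

Lemma size_interlace a b m : size (interlace a b m) = (size a + size b + m)%N.
Proof. by rewrite !size_cat !size_map size_iota addnA. Qed.

End Interlace.

(** * Telescoped weights of box removals *)

Section Weights.
Variable F : numFieldType.
Implicit Types a b : seq nat.

Definition lower_ratio (x : nat) (a : seq nat) : F :=
  \prod_(u <- rem x a) ((x%:R - 1 - u%:R) / (x%:R - u%:R)).

(* The coefficients [v (v-1) \prod_u (v-2-u)/(v-u)] of [euler_heS] at
   [v = 2x] and [v = 2(y+m)+1], the factors of the run of odd entries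
   1, 3, ..., 2m-1 being telescoped away. *)
Definition even_weight a b m x : F :=
  - (2%:R * x%:R * ((2 * m).+1%:R - 2%:R * x%:R)) * lower_ratio x a *
  \prod_(y <- b) (((2 * x)%:R - 2 - (2 * (y + m)).+1%:R) / ((2 * x)%:R - (2 * (y + m)).+1%:R)).

Definition odd_weight a b m y : F :=
  2%:R * (2 * (y + m)).+1%:R * y%:R * lower_ratio y b *
  \prod_(x <- a) (((2 * (y + m)).+1%:R - 2 - (2 * x)%:R) / ((2 * (y + m)).+1%:R - (2 * x)%:R)).

Lemma lower_ratio_eq0 x a : x \in a -> ~~ uniq (lower x a) -> uniq a ->
  lower_ratio x a = 0 \/ x = 0%N.
Proof.
move=> xa nu ua; case: (posnP x) => [->|x0]; [by right|left].
have h : x.-1 \in rem x a.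
  by move: nu; rewrite /= rem_uniq // andbT negbK.
rewrite /lower_ratio (perm_big _ (perm_to_rem h)) /= big_cons.
by rewrite -subn1 natrB // subrr !mul0r.
Qed.

(** Each numerator is the next denominator: the product is [(2x-2m-1)/(2x-1)], whose denominator
    cancels against [2x(2x-1)]. *)
Lemma even_telescope x m :
  (2 * x * (2 * x).-1)%:R *
  \prod_(t <- iota 0 m) (((2 * x)%:R - 2 - (2 * t).+1%:R) / ((2 * x)%:R - (2 * t).+1%:R)) =
  - (2%:R * x%:R * ((2 * m).+1%:R - 2%:R * x%:R)) :> F.
Proof.
elim: m => [|m IH].
  rewrite big_nil mulr1; case: x => [|x]; first by rewrite mul0n mulr0 mul0r oppr0.
  have -> : (2 * x.+1).-1 = (2 * x).+1 by lia.
  by rewrite !natrM -!natr1 natrM; ring.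
rewrite -[in iota _ _]addn1 iotaD big_cat /= big_seq1 mulrA IH add0n.
have h : (2 * x)%:R - (2 * m).+1%:R != 0 :> F.
  by rewrite subr_eq0 eqr_nat; lia.
have -> : (2 * m.+1).+1 = ((2 * m).+1 + 2)%N by lia.
rewrite natrD; move: h; rewrite natrM; move: ((2 * m).+1%:R : F) => M h.
by field.
Qed.

(** After cancelling 2 the factors are [(y+m-1-t)/(y+m-t)]; they telescope, and multiplying by [y+m]
    leaves [y]. *)
Lemma odd_telescope y m :
  ((2 * (y + m)).+1 * (2 * (y + m)).+1.-1)%:R *
  \prod_(t <- iota 0 m) (((2 * (y + m)).+1%:R - 2 - (2 * t).+1%:R) /
     ((2 * (y + m)).+1%:R - (2 * t).+1%:R)) =
  2%:R * (2 * (y + m)).+1%:R * y%:R :> F.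
Proof.
rewrite /= natrM -mulrA [2%:R * _]mulrC -[RHS]mulrA; congr (_ * _).
rewrite natrM -mulrA; congr (_ * _).
transitivity ((y + m)%:R *
   \prod_(t <- iota 0 m) (((y + m)%:R - 1 - t%:R) / ((y + m)%:R - t%:R)) : F).
  congr (_ * _); apply: eq_bigr => t _.
  have -> : (2 * (y + m)).+1%:R - (2 * t).+1%:R = 2 * ((y + m)%:R - t%:R) :> F.
    by rewrite -!natr1 !natrM; ring.
  have -> : (2 * (y + m)).+1%:R - 2 - (2 * t).+1%:R = 2 * ((y + m)%:R - 1 - t%:R) :> F.
    by rewrite -!natr1 !natrM; ring.
  by rewrite -mulf_div divff ?mul1r // pnatr_eq0.
elim: m => [|m IH]; first by rewrite big_nil mulr1 addn0.
rewrite /= big_cons (iotaDl 1 0) big_map addnS !subr0 mulrA -[_.+1%:R]natr1 addrK.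
rewrite mulrC [_ * (_ / _)]mulrC divfK ?natr1 ?pnatr_eq0 // -IH mulrC; congr (_ * _).
apply: eq_bigr => t _; rewrite -!natr1 natrD; congr (_ / _); ring.
Qed.

Lemma euler_interlace a b m : uniq a -> uniq b ->
  let s := interlace a b m in
  'X * (heS F s)^`() - ((sumn s)%:R - 'C(size s, 2)%:R) *: heS F s =
  \sum_(x <- a) even_weight a b m x *: heS F (interlace (lower x a) b m) +
  \sum_(y <- b) odd_weight a b m y *: heS F (interlace a (lower y b) m).
Proof.
move=> ua ub s; have us : uniq s by apply: uniq_interlace.
have dbl (x u : nat) : ((2 * x)%:R - 2 - (2 * u)%:R) / ((2 * x)%:R - (2 * u)%:R) =
    (x%:R - 1 - u%:R) / (x%:R - u%:R) :> F.
  have -> : (2 * x)%:R - (2 * u)%:R = 2 * (x%:R - u%:R) :> F by rewrite !natrM; ring.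
  have -> : (2 * x)%:R - 2 - (2 * u)%:R = 2 * (x%:R - 1 - u%:R) :> F.
    by rewrite !natrM; ring.
  by rewrite -mulf_div divff ?mul1r // pnatr_eq0.
have dblS (x u : nat) : ((2 * (x + m)).+1%:R - 2 - (2 * (u + m)).+1%:R) /
    ((2 * (x + m)).+1%:R - (2 * (u + m)).+1%:R) = (x%:R - 1 - u%:R) / (x%:R - u%:R) :> F.
  rewrite -dbl -!natr1 !natrM !natrD; congr (_ / _); ring.
rewrite euler_heS // {1}/s !big_cat !big_map /= [X in _ + (_ + X)]big1_seq ?addr0.
  congr (_ + _); apply: eq_big_seq => v vi.
    congr (_ *: _).
      rewrite (perm_big _ (rem_interlacel b m vi)) /= !big_cat !big_map /=.
      rewrite /even_weight -even_telescope /lower_ratio.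
      under eq_bigr => u _ do rewrite dbl.
      ring.
    apply: heS_perm; rewrite /interlace /lower /=.
    have -> : (2 * v).-2 = (2 * v.-1)%N by lia.
    by rewrite perm_cons; apply: rem_interlacel.
  transitivity (odd_weight a b m v *: heS F ((2 * (v + m)).+1.-2 :: rem (2 * (v + m)).+1 s)).
    congr (_ *: _).
    rewrite (perm_big _ (rem_interlacer a m vi)) /= !big_cat !big_map /=.
    rewrite /odd_weight -odd_telescope /lower_ratio.
    under [X in _ * (_ * (X * _))]eq_bigr => u _ do rewrite dblS.
    rewrite /=; ring.
  (* At [v = 0] the two arguments of [heS] need not agree, but the weight contains the factor
     [v]. *)
  case: (posnP v) => [->|v0]; first by rewrite /odd_weight mulr0 !mul0r !scale0r.
  congr (_ *: _); apply: heS_perm.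
  have -> : (2 * (v + m)).+1.-2 = (2 * (v.-1 + m)).+1 by lia.
  rewrite (permPr (interlace_consr _ _ _ _)) perm_cons.
  exact: rem_interlacer.
(* The run contributes nothing: the entry 1 has [v (v-1) = 0], and for [2t+1] with [t > 0] the entry
   [2t-1] is present and makes a factor zero. *)
move=> t /andP[_]; rewrite mem_iota /= => tm.
case: (posnP t) => [->|t0]; first by rewrite !muln0 mul0r scale0r.
have h : (2 * t.-1).+1 \in rem (2 * t).+1 s.
  rewrite mem_rem_uniq // inE; apply/andP; split; first by lia.
  rewrite !mem_cat; apply/orP; right; apply/orP; right.
  by apply: (map_f (fun t => (2 * t).+1)); rewrite mem_iota; lia.
rewrite (perm_big _ (perm_to_rem h)) /= big_cons.
have -> : (2 * t).+1%:R = (2 * t.-1).+1%:R + 2 :> F.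
  by rewrite -(natrD _ _ 2); congr _%:R; lia.
by rewrite addrK subrr !mul0r mulr0 scale0r.
Qed.

End Weights.

(** * Convergence with rate [O(1/k)] *)

Section RateOfConvergence.
Variable R : archiRealFieldType.
Implicit Types (u v : nat -> R) (l c : R).

(** This is [u k = l + O(1/k)]; the strict bound [k0 < k] ensures [k > 0]. *)
Definition rate_cvg u l :=
  exists c k0, 0 <= c /\ forall k, (k0 < k)%N -> `|u k - l| <= c / k%:R.

Lemma rate_cvg_ext u v l : (forall k, (0 < k)%N -> u k = v k) ->
  rate_cvg u l -> rate_cvg v l.
Proof.
move=> e [c [k0 [c0 h]]]; exists c, k0; split=> // k kk; rewrite -e ?h //.
exact: leq_ltn_trans kk.
Qed.

Lemma rate_cvg_cst l : rate_cvg (fun=> l) l.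
Proof. by exists 0, 0%N; split=> // k _; rewrite subrr normr0 mul0r. Qed.

Lemma rate_cvgD u v l l' : rate_cvg u l -> rate_cvg v l' ->
  rate_cvg (fun k => u k + v k) (l + l').
Proof.
move=> [c [k0 [c0 h]]] [c' [k0' [c0' h']]]; exists (c + c'), (maxn k0 k0').
split=> [|k]; first exact: addr_ge0.
rewrite gtn_max => /andP[/h hk /h' hk']; rewrite mulrDl opprD addrACA.
by apply: le_trans (ler_normD _ _) _; apply: lerD.
Qed.

Lemma rate_cvgM u v l l' : rate_cvg u l -> rate_cvg v l' ->
  rate_cvg (fun k => u k * v k) (l * l').
Proof.
move=> [c [k0 [c0 h]]] [c' [k0' [c0' h']]].
exists (c * (`|l'| + c') + `|l| * c'), (maxn k0 k0'); split=> [|k].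
  by rewrite addr_ge0 ?mulr_ge0 ?addr_ge0.
rewrite gtn_max => /andP[kk /h' hk']; have hk := h _ kk.
have k1 : 1 <= k%:R :> R by rewrite ler1n (leq_ltn_trans _ kk).
have kp : 0 < k%:R :> R by apply: lt_le_trans k1.
have vb : `|v k| <= `|l'| + c'.
  rewrite -[v k](subrK l') addrC; apply: le_trans (ler_normD _ _) _.
  rewrite lerD2l (le_trans hk') // ler_pdivrMr // ler_peMr //.
have -> : u k * v k - l * l' = (u k - l) * v k + l * (v k - l') by ring.
apply: le_trans (ler_normD _ _) _; rewrite !normrM mulrDl; apply: lerD.
  by rewrite mulrAC ler_pM.
by rewrite -mulrA ler_wpM2l.
Qed.

Lemma rate_cvg_sum (I : eqType) (r : seq I) (f : I -> nat -> R) (l : I -> R) :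
  (forall i, i \in r -> rate_cvg (f i) (l i)) ->
  rate_cvg (fun k => \sum_(i <- r) f i k) (\sum_(i <- r) l i).
Proof.
elim: r => [|x r IH] h.
  rewrite big_nil; apply: rate_cvg_ext (rate_cvg_cst 0) => k _; by rewrite big_nil.
rewrite big_cons; apply: (@rate_cvg_ext (fun k => f x k + \sum_(i <- r) f i k)).
  by move=> k _; rewrite big_cons.
apply: rate_cvgD; first by apply: h; rewrite mem_head.
by apply: IH => i ir; apply: h; rewrite inE ir orbT.
Qed.

Lemma rate_cvg_prod1 (I : Type) (r : seq I) (f : I -> nat -> R) :
  (forall i, rate_cvg (f i) 1) -> rate_cvg (fun k => \prod_(i <- r) f i k) 1.
Proof.
move=> h; elim: r => [|x r IH].
  by apply: rate_cvg_ext (rate_cvg_cst 1) => k _; rewrite big_nil.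
apply: (@rate_cvg_ext (fun k => f x k * \prod_(i <- r) f i k)).
  by move=> k _; rewrite big_cons.
by rewrite -[X in rate_cvg _ X]mulr1; apply: rate_cvgM.
Qed.

Lemma rate_cvgV1 u : rate_cvg u 1 -> rate_cvg (fun k => (u k)^-1) 1.
Proof.
(* Beyond [2c] the distance to 1 is at most one half, so [u k >= 1/2] and inversion at most doubles
   the error. *)
move=> [c [k0 [c0 h]]]; exists (2 * c), (maxn k0 (Num.bound (2 * c))); split=> [|k].
  by rewrite mulr_ge0.
rewrite gtn_max => /andP[kk kb]; have hk := h _ kk.
have kp : 0 < k%:R :> R by rewrite ltr0n (leq_ltn_trans _ kk).
have kc : 2 * c < k%:R.
  apply: lt_trans (archi_boundP _) _; first by rewrite mulr_ge0.
  by rewrite ltr_nat.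
have ck : c / k%:R <= 2^-1 by rewrite ler_pdivrMr // mulrC ler_pdivlMr // mulrC ltW.
have up : 2^-1 <= u k by move: hk ck; rewrite ler_norml => /andP[]; lra.
have u0 : 0 < u k by lra.
have -> : (u k)^-1 - 1 = (1 - u k) / u k by rewrite mulrBl mul1r divff // gt_eqF.
rewrite normrM normfV distrC (gtr0_norm u0) ler_pdivrMr //.
apply: le_trans hk _; rewrite -[2 * c / _]mulrA.
have : 0 <= c / k%:R by rewrite divr_ge0 // ltW.
move: (c / k%:R) => q q0; rewrite mulrAC ler_peMl //; lra.
Qed.

Lemma rate_cvg_affine c : rate_cvg (fun k => (2 * k%:R + c) / (2 * k%:R)) 1.
Proof.
exists (`|c|), 0%N; split=> // k k0.
have kp : 0 < k%:R :> R by rewrite ltr0n.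
have -> : (2 * k%:R + c) / (2 * k%:R) - 1 = c / k%:R / 2 by field; rewrite gt_eqF.
rewrite !normrM !normfV (gtr0_norm kp) (@gtr0_norm _ 2) //.
by rewrite ler_pdivrMr // ler_peMr ?divr_ge0 // ?ltW //; lra.
Qed.

Lemma rate_cvg_affine_ratio c c' :
  rate_cvg (fun k => (2 * k%:R + c) / (2 * k%:R + c')) 1.
Proof.
apply: (@rate_cvg_ext (fun k => ((2 * k%:R + c) / (2 * k%:R)) *
   ((2 * k%:R + c') / (2 * k%:R))^-1)); last first.
  rewrite -[X in rate_cvg _ X]mulr1; apply: rate_cvgM; first exact: rate_cvg_affine.
  exact/rate_cvgV1/rate_cvg_affine.
move=> k k0; rewrite invf_div mulrA divfK // mulf_neq0 // pnatr_eq0 -?lt0n //.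
Qed.

(** In the divisor [4k], a factor 2 comes from [2 (i - N)] in the coefficient recursion and [2k]
    from the rescaling, whose exponent drops with each box. The growth comes from [2m+1-2x], left by
    the telescoped run; the quotients over [b] tend to 1. *)
Lemma rate_cvg_even_weight a b m0 x :
  rate_cvg (fun k => even_weight R a b (m0 + k) x / (4 * k%:R))
           (- (x%:R * lower_ratio R x a)).
Proof.
apply: (@rate_cvg_ext (fun k => - (x%:R * lower_ratio R x a) *
  ((2 * k%:R + (2 * m0%:R + 1 - 2 * x%:R)) / (2 * k%:R)) *
  \prod_(y <- b) ((2 * k%:R + (2 * m0%:R + 2 * y%:R + 3 - 2 * x%:R)) /
                 (2 * k%:R + (2 * m0%:R + 2 * y%:R + 1 - 2 * x%:R))))).
  move=> k k0; rewrite /even_weight [RHS]mulrAC; congr (_ * _).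
    rewrite -[(2 * (m0 + k)).+1%:R]natr1 natrM natrD.
    by field; rewrite pnatr_eq0 -lt0n.
  apply: eq_bigr => y _; rewrite -[(2 * _).+1%:R]natr1 !natrM !natrD.
  rewrite -[RHS]mulrNN -invrN; congr (_ / _); ring.
rewrite -[X in rate_cvg _ X]mulr1 -[X in rate_cvg _ (X * _)]mulr1.
apply: rate_cvgM; first apply: rate_cvgM; first exact: rate_cvg_cst.
  exact: rate_cvg_affine.
by apply: rate_cvg_prod1 => y; apply: rate_cvg_affine_ratio.
Qed.

Lemma rate_cvg_odd_weight a b m0 y :
  rate_cvg (fun k => odd_weight R a b (m0 + k) y / (4 * k%:R))
           (y%:R * lower_ratio R y b).
Proof.
apply: (@rate_cvg_ext (fun k => y%:R * lower_ratio R y b *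
  ((2 * k%:R + (2 * m0%:R + 2 * y%:R + 1)) / (2 * k%:R)) *
  \prod_(x <- a) ((2 * k%:R + (2 * m0%:R + 2 * y%:R - 1 - 2 * x%:R)) /
                 (2 * k%:R + (2 * m0%:R + 2 * y%:R + 1 - 2 * x%:R))))).
  move=> k k0; rewrite /odd_weight [RHS]mulrAC; congr (_ * _).
    rewrite -[(2 * _).+1%:R]natr1 natrM !natrD.
    by field; rewrite pnatr_eq0 -lt0n.
  by apply: eq_bigr => x _; rewrite -[(2 * _).+1%:R]natr1 !natrM !natrD; congr (_ / _); ring.
rewrite -[X in rate_cvg _ X]mulr1 -[X in rate_cvg _ (X * _)]mulr1.
apply: rate_cvgM; first apply: rate_cvgM; first exact: rate_cvg_cst.
  exact: rate_cvg_affine.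
by apply: rate_cvg_prod1 => x; apply: rate_cvg_affine_ratio.
Qed.

End RateOfConvergence.

(** * Limits of the coefficients *)

Lemma bin2_double n : ('C(n, 2) * 2 + n = n * n)%N.
Proof. by elim: n => // n IH; rewrite binS bin1; nia. Qed.

(** By pigeonhole some entry is at least [size s - 1]; remove it and induct. *)
Lemma bin2_leq_sumn (s : seq nat) : uniq s -> ('C(size s, 2) <= sumn s)%N.
Proof.
elim: {s}(size s) {-2}s (erefl (size s)) => [|n IH] s ss us; first by rewrite ss.
have [x xs nx] : exists2 x, x \in s & (n <= x)%N.
  apply/hasP; rewrite -[has _ _]negbK -all_predC; apply/negP => /allP h.
  have : (size s <= size (iota 0 n))%N.
    apply: uniq_leq_size => // y /h /=; rewrite mem_iota; lia.
  by rewrite size_iota ss ltnn.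
have e := perm_to_rem xs.
have sr : size (rem x s) = n by rewrite size_rem // ss.
rewrite ss binS bin1 (perm_sumn e) /= addnC leq_add // -sr IH ?rem_uniq //.
Qed.

(* The size of the partition with beta-set [s]. *)
Definition excess (s : seq nat) : nat := (sumn s - 'C(size s, 2))%N.

Lemma excessK (s : seq nat) : uniq s -> (excess s + 'C(size s, 2) = sumn s)%N.
Proof. by move=> us; rewrite subnK // bin2_leq_sumn. Qed.

Lemma excess_lower (x : nat) (a : seq nat) : x \in a -> (0 < x)%N -> uniq (lower x a) -> uniq a ->
  excess a = (excess (lower x a)).+1.
Proof.
move=> xa x0 ul ua; have := excessK ul; have := excessK ua.
have := sumn_lower xa x0; rewrite size_lower //.
by move: (excess _) (excess _) (sumn _) (sumn _) => p q r t; lia.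
Qed.

(** The odd runner has [k] entries more than the even one, so the 2-core has size [C(k+1,2)]; each
    box of the 2-quotient counts twice. *)
Lemma sumn_interlace_excess a b m0 k : uniq a -> uniq b -> (m0 + size b = size a)%N ->
  let s := interlace a b (m0 + k) in
  ('C(k.+1, 2) + 2 * (excess a + excess b) + 'C(size s, 2) = sumn s)%N.
Proof.
move=> ua ub mb s; rewrite sumn_interlace /s size_interlace.
rewrite -(excessK ua) -(excessK ub) -mb.
have := bin2_double (m0 + size b); have := bin2_double (size b).
have := bin2_double k.+1; have := bin2_double (m0 + size b + size b + (m0 + k)).
move: 'C(_, _) 'C(_, _) 'C(_, _) 'C(_, _) => p q r t; rewrite !expnS expn0.
move: (size b) (excess a) (excess b) => n A B.
nia.
Qed.

(** * Recursion for the rescaled coefficients and its limit *)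

Section CoefficientLimit.
Variable R : archiRealFieldType.
Implicit Types a b : seq nat.

Definition limit_poly A B : {poly R} := ('X + 1) ^+ A * ('X - 1) ^+ B.

(** Logarithmic derivative: [A X/(X+1) - A = -A/(X+1)], and likewise for [B]. This is the limit form
    of the box-removal recursion. *)
Lemma euler_limit_poly A B :
  'X * (limit_poly A B)^`() - (A + B)%:R *: limit_poly A B =
  - A%:R *: limit_poly A.-1 B + B%:R *: limit_poly A B.-1.
Proof.
have hp : 'X + 1 = 'X - (-1)%:P :> {poly R} by rewrite polyCN opprK.
have dA : (('X + 1 : {poly R}) ^+ A)^`() = A%:R%:P * ('X + 1) ^+ A.-1.
  by rewrite hp deriv_exp -mulr_natl derivXsubC mul1r polyC_natr.
have dB : (('X - 1 : {poly R}) ^+ B)^`() = B%:R%:P * ('X - 1) ^+ B.-1.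
  by rewrite deriv_exp -mulr_natl -polyC1 derivXsubC polyC1 mul1r polyC_natr.
rewrite /limit_poly derivM {}dA {}dB -!mul_polyC natrD polyCD polyCN.
case: A => [|A]; case: B => [|B]; rewrite /= ?exprS; ring.
Qed.

Lemma limit_poly_monic A B :
  limit_poly A B \is monic /\ size (limit_poly A B) = (A + B).+1.
Proof.
have hp : 'X + 1 = 'X - (-1)%:P :> {poly R} by rewrite polyCN opprK.
rewrite /limit_poly hp -[1 in X in _ * X]polyC1; split.
  by rewrite monicMl monic_exp ?monicXsubC.
by rewrite size_Mmonic ?monic_neq0 ?monic_exp ?monicXsubC ?size_exp_XsubC //; lia.
Qed.

(** Coefficient of [x^i] in [R(2kx) / (2k)^N], with [N] the total size of the 2-quotient. *)
Definition scaled_coef a b m0 i (k : nat) : R :=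
  (heS R (interlace a b (m0 + k)))`_('C(k.+1, 2) + 2 * i) *
  (2 * k%:R) ^+ i / (2 * k%:R) ^+ (excess a + excess b).

Lemma scaled_coef_lead a b m0 k : uniq a -> uniq b -> (m0 + size b = size a)%N ->
  (0 < k)%N -> scaled_coef a b m0 (excess a + excess b) k = 1.
Proof.
move=> ua ub mb k0; rewrite /scaled_coef heS_lead ?uniq_interlace //.
  by rewrite mul1r divff // expf_neq0 // mulf_neq0 // pnatr_eq0 -?lt0n.
exact: sumn_interlace_excess.
Qed.

Lemma coef_heS_interlace_gt a b m0 k i : uniq a -> uniq b -> (m0 + size b = size a)%N ->
  (excess a + excess b < i)%N ->
  (heS R (interlace a b (m0 + k)))`_('C(k.+1, 2) + 2 * i) = 0.
Proof.
move=> ua ub mb hi; rewrite nth_default //.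
by apply: leq_trans (size_heS _ (sumn_interlace_excess k ua ub mb)) _; lia.
Qed.

(** Compare coefficients of degree [e] in [euler_interlace]: the derivative contributes [e], the
    partition has size [C(k+1,2) + 2N], and the difference [2 (i - N)] explains the halved
    weights. *)
Lemma scaled_coef_rec a b m0 i k : uniq a -> uniq b -> (m0 + size b = size a)%N ->
  let N := (excess a + excess b)%N in
  let e := ('C(k.+1, 2) + 2 * i)%N in
  (i%:R - N%:R) * scaled_coef a b m0 i k =
  (\sum_(x <- a) even_weight R a b (m0 + k) x / 2 *
      ((heS R (interlace (lower x a) b (m0 + k)))`_e * (2 * k%:R) ^+ i / (2 * k%:R) ^+ N)) +
  (\sum_(y <- b) odd_weight R a b (m0 + k) y / 2 *
      ((heS R (interlace a (lower y b) (m0 + k)))`_e * (2 * k%:R) ^+ i / (2 * k%:R) ^+ N)).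
Proof.
move=> ua ub mb N e; rewrite /scaled_coef -/N -/e.
have /(congr1 (fun p : {poly R} => p`_e)) := @euler_interlace R a b (m0 + k) ua ub.
rewrite -(sumn_interlace_excess k ua ub mb) natrD addrK -/N.
rewrite coefB coefZ coefXM coefD !coef_sum.
have -> : (if e == 0 then 0 else (heS R (interlace a b (m0 + k)))^`()`_e.-1) =
  e%:R * (heS R (interlace a b (m0 + k)))`_e.
  case: e => [|e] /=; first by rewrite mul0r.
  by rewrite coef_deriv mulr_natl.
have -> : forall z, e%:R * z - ('C(k.+1, 2) + 2 * N)%:R * z = 2 * (i%:R - N%:R) * z :> R.
  move=> z; rewrite -mulrBl /e; move: 'C(k.+1, 2) N => c n.
  by rewrite (natrD _ c) (natrD _ c) !natrM; ring.
move=> h; pose q : R := (2 * k%:R) ^+ i / (2 * k%:R) ^+ N / 2.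
have hq w t : w / 2 * (t * (2 * k%:R) ^+ i / (2 * k%:R) ^+ N) = w * t * q :> R.
  by rewrite /q; move: (_ ^-1) ((_ ^+ N)^-1) => u v; ring.
transitivity (2 * (i%:R - N%:R) * (heS R (interlace a b (m0 + k)))`_e * q).
  rewrite -hq mulrAC; congr (_ * _); rewrite mulrAC divff ?mul1r // pnatr_eq0 //.
rewrite {}h mulrDl !mulr_suml.
by congr (_ + _); apply: eq_bigr => x _; rewrite hq coefZ.
Qed.

(** The limit weight is a factor of the weight itself, so where it is zero the term is absent for
    every [m]. *)
Lemma even_weight_degenerate a b m x : uniq a -> x \in a ->
  x%:R * lower_ratio R x a = 0 -> even_weight R a b m x = 0.
Proof.
move=> ua xa h; rewrite /even_weight.
have -> : - (2 * x%:R * ((2 * m).+1%:R - 2 * x%:R)) * lower_ratio R x a =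
  - (2 * ((2 * m).+1%:R - 2 * x%:R)) * (x%:R * lower_ratio R x a) by ring.
by rewrite h mulr0 mul0r.
Qed.

Lemma rate_cvg_scaled_coef a b m0 i : uniq a -> uniq b -> (m0 + size b = size a)%N ->
  rate_cvg (scaled_coef a b m0 i) (limit_poly (excess a) (excess b))`_i.
Proof.
have [n] := ubnP (sumn a + sumn b)%N.
elim: n a b => // n IH a b hn ua ub mb.
set N := (excess a + excess b)%N.
(* For [i = N] the recursion degenerates, and the leading coefficient is 1 on both sides. *)
have [->|iN] := eqVneq i N.
  have -> : (limit_poly (excess a) (excess b))`_N = 1.
    have [/monicP h sz] := limit_poly_monic (excess a) (excess b).
    by rewrite -h /lead_coef sz.
  apply: rate_cvg_ext (rate_cvg_cst 1) => k k0; by rewrite scaled_coef_lead.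
have iN0 : i%:R - N%:R != 0 :> R by rewrite subr_eq0 eqr_nat.
(* One box fewer lowers the exponent of [2k] by one; the spare [2k] joins the 2 in the divisor
   [4k]. *)
have scale (k T w : R) N' : k != 0 ->
    w / (4 * k) * (T * (2 * k) ^+ i / (2 * k) ^+ N') =
    w / 2 * (T * (2 * k) ^+ i / (2 * k) ^+ N'.+1).
  move=> k0; have : (2 * k) ^+ N' != 0 by rewrite expf_neq0 // mulf_neq0 // pnatr_eq0.
  rewrite exprS; move: ((2 * k) ^+ i) ((2 * k) ^+ N') => p q q0.
  by field; rewrite q0 k0.
have kR k : (0 < k)%N -> k%:R != 0 :> R by rewrite pnatr_eq0 -lt0n.
have even_term x : x \in a ->
  rate_cvg (fun k => even_weight R a b (m0 + k) x / 2 *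
      ((heS R (interlace (lower x a) b (m0 + k)))`_('C(k.+1, 2) + 2 * i) *
       (2 * k%:R) ^+ i / (2 * k%:R) ^+ N))
    (- (x%:R * lower_ratio R x a) * (limit_poly (excess a).-1 (excess b))`_i).
  (* A nonzero limit weight excludes [x = 0] and forbidden removals, so the induction hypothesis
     applies to [lower x a]. *)
  move=> xa; have [d0|d0] := eqVneq (x%:R * lower_ratio R x a) 0.
    rewrite d0 oppr0 mul0r; apply: rate_cvg_ext (rate_cvg_cst 0) => k _.
    by rewrite even_weight_degenerate // !mul0r.
  have x0 : (0 < x)%N by case: x d0 {xa} => //; rewrite mul0r eqxx.
  have ul : uniq (lower x a).
    by apply: contraR d0 => /(lower_ratio_eq0 R xa) /(_ ua) [] ->; rewrite ?mulr0 ?mul0r.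
  have ex := excess_lower xa x0 ul ua.
  rewrite [in limit_poly _ _]ex /=.
  apply: (@rate_cvg_ext _ (fun k => even_weight R a b (m0 + k) x / (4 * k%:R) *
     scaled_coef (lower x a) b m0 i k)).
    by move=> k k0; rewrite /scaled_coef scale ?kR // /N ex addSn.
  apply: rate_cvgM; first exact: rate_cvg_even_weight.
  apply: IH => //; last by rewrite size_lower.
  by move: hn; rewrite -(sumn_lower xa x0); lia.
have odd_term y : y \in b ->
  rate_cvg (fun k => odd_weight R a b (m0 + k) y / 2 *
      ((heS R (interlace a (lower y b) (m0 + k)))`_('C(k.+1, 2) + 2 * i) *
       (2 * k%:R) ^+ i / (2 * k%:R) ^+ N))
    ((y%:R * lower_ratio R y b) * (limit_poly (excess a) (excess b).-1)`_i).
  move=> yb; have [d0|d0] := eqVneq (y%:R * lower_ratio R y b) 0.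
    rewrite d0 mul0r; apply: rate_cvg_ext (rate_cvg_cst 0) => k _.
    by rewrite /odd_weight -(mulrA _ y%:R) d0 mulr0 !mul0r.
  have y0 : (0 < y)%N by case: y d0 {yb} => //; rewrite mul0r eqxx.
  have ul : uniq (lower y b).
    by apply: contraR d0 => /(lower_ratio_eq0 R yb) /(_ ub) [] ->; rewrite ?mulr0 ?mul0r.
  have ex := excess_lower yb y0 ul ub.
  rewrite [in limit_poly _ _]ex /=.
  apply: (@rate_cvg_ext _ (fun k => odd_weight R a b (m0 + k) y / (4 * k%:R) *
     scaled_coef a (lower y b) m0 i k)).
    by move=> k k0; rewrite /scaled_coef scale ?kR // /N ex addnS.
  apply: rate_cvgM; first exact: rate_cvg_odd_weight.
  apply: IH => //; last by rewrite size_lower.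
  by move: hn; rewrite -(sumn_lower yb y0); lia.
have := rate_cvgM (rate_cvg_cst (i%:R - N%:R)^-1)
  (rate_cvgD (rate_cvg_sum even_term) (rate_cvg_sum odd_term)).
have -> : (i%:R - N%:R)^-1 * (\sum_(x <- a) - (x%:R * lower_ratio R x a) *
     (limit_poly (excess a).-1 (excess b))`_i +
   \sum_(y <- b) (y%:R * lower_ratio R y b) * (limit_poly (excess a) (excess b).-1)`_i) =
  (limit_poly (excess a) (excess b))`_i.
  apply: (canLR (mulKf iN0)).
  (* The limit weights add up to [- excess a] and [excess b], as [euler_limit_poly] requires. *)
  rewrite -!mulr_suml sumrN !sum_lower_ratio //.
  rewrite -(excessK ua) -(excessK ub) !natrD !addrK.
  have /(congr1 (fun p : {poly R} => p`_i)) := euler_limit_poly (excess a) (excess b).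
  rewrite coefB coefD !coefZ coefXM => <-; rewrite mulrBl natrD; congr (_ - _).
  by case: (i) => [|j] /=; rewrite ?mul0r // coef_deriv mulr_natl.
apply: rate_cvg_ext => k k0; rewrite -scaled_coef_rec //.
by rewrite mulKf.
Qed.

End CoefficientLimit.

(** * Maya diagrams *)

Section MayaDiagrams.
Local Open Scope nat_scope.
Implicit Types lam asc : seq nat.

Definition gaps (M : pred nat) (n : nat) : nat := count (fun j => ~~ M j) (iota 0 n).

Lemma gapsS M n : gaps M n.+1 = gaps M n + ~~ M n.
Proof. by rewrite /gaps -[n.+1]addn1 iotaD count_cat /= add0n addn0. Qed.

Lemma gaps_homo M : {homo gaps M : m n / m <= n}.
Proof. by move=> m n /subnKC <-; rewrite /gaps iotaD count_cat leq_addr. Qed.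

(** Degrees of a partition whose parts are listed in ascending order. *)
Definition increments (asc : seq nat) : seq nat :=
  mkseq (fun i => nth 0 asc i + i) (size asc).

Lemma increments_rcons asc c :
  increments (rcons asc c) = rcons (increments asc) (c + size asc).
Proof.
rewrite /increments size_rcons mkseqS nth_rcons ltnn eqxx; congr rcons.
apply/eq_in_map => i; rewrite mem_iota nth_rcons /= => h.
by rewrite add0n in h; rewrite h.
Qed.

Lemma degs_rev asc : degs (rev asc) = rev (increments asc).
Proof.
apply: (@eq_from_nth _ 0).
  by rewrite size_rev size_mkseq size_map size_iota size_rev.
rewrite size_map size_iota size_rev => i hi.
rewrite (nth_map 0) ?size_iota ?size_rev // nth_iota ?size_rev // add0n /degvec.
rewrite size_rev !nth_rev ?size_mkseq // nth_mkseq //; lia.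
Qed.

(* The elements below the first gap form a full prefix 0..t-1, which does not
   contribute parts; beyond it, each element is t plus an entry of the beta-set. *)
Lemma maya_prefix M B :
  let c := [seq x <- [seq gaps M m | m <- iota 0 B & M m] | 0 < x] in
  exists t, [/\ [seq m <- iota 0 B | M m] = iota 0 t ++ map (addn t) (increments c),
    t + size c + gaps M B = B & (gaps M B = 0 -> c = [::])].
Proof.
elim: B => [|B [t [e s z]]]; first by exists 0.
have -> : iota 0 B.+1 = rcons (iota 0 B) B by rewrite -cats1 -[B.+1]addn1 iotaD.
rewrite filter_rcons gapsS; case MB: (M B); last first.
  by exists t; split; [exact: e | move: s => /=; lia | rewrite addn1].
rewrite map_rcons filter_rcons addn0; move: e s z; move: [seq x <- [seq _ | _ <- _] | _] => d.
(* Before the first gap, [B] lengthens the full prefix; afterwards it equals [t] plus its gap count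
   plus the number of parts already found. *)
move=> -> s z; case: posnP => g0.
  move: s; rewrite (z g0) g0 /= !addn0 => ->.
  by exists B.+1; rewrite !cats0 !addn0 -cats1 -[B.+1]addn1 iotaD.
exists t; rewrite increments_rcons map_rcons rcons_cat size_rcons; split.
- by congr (_ ++ rcons _ _); lia.
- lia.
- lia.
Qed.

(** The degrees are the Maya elements beyond the full prefix, lowered by its length; [heS] sees
    neither the prefix nor the order. *)
Lemma degs_of_maya (F : numFieldType) (M : pred nat) B :
  heS F (degs (sort (fun a b => b <= a)
    [seq c <- [seq count (fun j => ~~ M j) (iota 0 m) | m <- iota 0 B & M m] | 0 < c])) =
  heS F [seq m <- iota 0 B | M m].
Proof.
have [t [e _ _]] := maya_prefix M B.
rewrite -/(gaps M) [in RHS]e heS_iota_cat; set c := [seq x <- _ | 0 < x].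
(* Gap counts are non-decreasing, so sorting in descending order only reverses them. *)
suff -> : sort (fun a b => b <= a) c = rev c.
  by rewrite degs_rev; apply: heS_perm; rewrite perm_rev.
apply: (@sorted_eq _ (fun a b : nat => b <= a)).
- by move=> x y z xy yz; apply: leq_trans xy.
- by move=> x y; rewrite andbC => /anti_leq.
- by apply: sort_sorted => x y; rewrite leq_total.
- rewrite rev_sorted; apply: sorted_filter; first exact: leq_trans.
  apply: (homo_sorted (@gaps_homo M)); apply: sorted_filter; first exact: leq_trans.
  exact: iota_sorted.
- by rewrite perm_sort perm_sym perm_rev.
Qed.

(** * Degree vectors, shifts and the diagram of the 2-quotient *)

Lemma size_degs lam : size (degs lam) = size lam.
Proof. by rewrite size_map size_iota. Qed.

Lemma degs_uniq lam : is_partition lam -> uniq (degs lam).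
Proof.
move=> /andP[so _]; rewrite map_inj_in_uniq ?iota_uniq // => i j.
wlog ij : i j / i <= j.
  by move=> w; case: (leqP i j) => [|/ltnW] h *; [|symmetry]; apply: w.
rewrite !mem_iota /= => hi hj; rewrite /degvec.
have tr : transitive (fun a b : nat => b <= a) by move=> x y z h1 h2; apply: leq_trans h1.
have : nth 0 lam j <= nth 0 lam i by apply: (sorted_leq_nth tr) => //=.
lia.
Qed.

Lemma degvec_leq lam i : i < size lam -> degvec lam i <= psize lam + size lam.
Proof.
move=> hi; rewrite leq_add ?leq_subr // /psize.
elim: lam i hi => //= x lam IH [_|i hi]; first exact: leq_addr.
by apply: leq_trans (IH _ hi) _; apply: leq_addl.
Qed.

Lemma mem_degs_leq lam n : n \in degs lam -> n <= psize lam + size lam.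
Proof. by case/mapP => i; rewrite mem_iota => hi ->; apply: degvec_leq. Qed.

Lemma sumn_iota0 n : sumn (iota 0 n) = 'C(n, 2).
Proof. by rewrite -bin2_sum sumnE /index_iota subn0. Qed.

Lemma excess_degs lam : excess (degs lam) = psize lam.
Proof.
rewrite /excess size_degs /degs sumnE big_map big_split /=.
have -> : \sum_(i <- iota 0 (size lam)) nth 0 lam i = psize lam.
  by rewrite /psize sumnE [RHS](big_nth 0) /index_iota subn0.
have -> : \sum_(i <- iota 0 (size lam)) (size lam - i.+1) = 'C(size lam, 2).
  rewrite -bin2_sum big_nat_rev /= /index_iota subn0.
  by apply: eq_bigr => i _; rewrite add0n.
by rewrite addnK.
Qed.

Definition shift_maya (s : nat) (d : seq nat) : seq nat := iota 0 s ++ map (addn s) d.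

Lemma size_shift_maya s d : size (shift_maya s d) = s + size d.
Proof. by rewrite size_cat size_iota size_map. Qed.

Lemma excess_shift_maya s d : excess (shift_maya s d) = excess d.
Proof.
rewrite /excess size_shift_maya sumn_cat sumn_iota0.
have -> : sumn (map (addn s) d) = s * size d + sumn d.
  by elim: d => [|x d IH] /=; [rewrite muln0 | rewrite IH mulnS; lia].
have := bin2_double (s + size d); have := bin2_double s; have := bin2_double (size d).
by move: 'C(_, _) 'C(_, _) 'C(_, _) => x y z; nia.
Qed.

Lemma shift_maya_uniq s d : uniq d -> uniq (shift_maya s d).
Proof.
move=> ud; rewrite cat_uniq iota_uniq map_inj_uniq ?ud; last exact: addnI.
rewrite andbT; apply/hasPn => _ /mapP[i _ ->]; rewrite mem_iota; lia.
Qed.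

Lemma mem_shift_maya s lam h : (h \in shift_maya s (degs lam)) = inMaya lam s h.
Proof.
rewrite mem_cat mem_iota /= add0n /inMaya; case: ltnP => //= sh.
by rewrite -{1}(subnKC sh) mem_map //; apply: addnI.
Qed.

(** Even members come from the shifted diagram of [mu]; odd ones lie in the run below [size mu + k]
    or come from a degree of [nu]. [PhiBound] exceeds them all. *)
Lemma perm_PhiMaya mu nu k : is_partition mu -> is_partition nu ->
  perm_eq [seq n <- iota 0 (PhiBound mu nu k) | PhiMaya mu nu k n]
    (interlace (shift_maya (size nu) (degs mu)) (degs nu) (size mu + k)).
Proof.
move=> pm pn; apply: uniq_perm.
- by rewrite filter_uniq ?iota_uniq.
- by apply: uniq_interlace; rewrite ?shift_maya_uniq ?degs_uniq.
move=> n; rewrite mem_filter mem_iota /= add0n.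
rewrite /PhiMaya; apply/idP/idP.
  case: ifP => od.
    rewrite /inMaya !mem_cat => /andP[h _]; apply/orP; right; apply/orP.
    move: h; case: (ltnP n./2 (size mu + k)) => /= hn h; [right|left]; apply/mapP.
      by exists n./2; rewrite ?mem_iota // -{1}(odd_double_half n) od; lia.
    by exists (n./2 - (size mu + k)); rewrite // -{1}(odd_double_half n) od; lia.
  rewrite -mem_shift_maya => /andP[h _]; rewrite mem_cat; apply/orP; left.
  by apply/mapP; exists n./2 => //; rewrite -{1}(odd_double_half n) od; lia.
rewrite !mem_cat => /or3P[] /mapP[x hx ->].
- have e : (2 * x)./2 = x by lia.
  rewrite e oddM /= -mem_shift_maya hx /=.
  move: hx; rewrite /PhiBound mem_cat mem_iota => /orP[|/mapP[d /mem_degs_leq + ->]]; lia.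
- have -> : odd (2 * (x + (size mu + k))).+1 by lia.
  have -> : (2 * (x + (size mu + k))).+1./2 = x + (size mu + k) by lia.
  by rewrite /inMaya addnK hx orbT; move: (mem_degs_leq hx); rewrite /PhiBound; lia.
- have -> : odd (2 * x).+1 by lia.
  have -> : (2 * x).+1./2 = x by lia.
  by move: hx; rewrite mem_iota /inMaya /PhiBound; lia.
Qed.

End MayaDiagrams.

Unset Implicit Arguments.
Local Open Scope complex_scope.

(** * The uniform limit *)

(** The coefficient limits are taken over a real field; this base change carries them to complex
    polynomials. *)
Lemma map_heS (F K : numFieldType) (f : {rmorphism F -> K}) (s : seq nat) :
  heS K s = map_poly f (heS F s).
Proof.
have fHe n : map_poly f (He F n) = He K n.
  have H0 (L : fieldType) : He L 0 = 1 by [].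
  have H1 (L : fieldType) : He L 1 = 'X by [].
  suff: map_poly f (He F n) = He K n /\ map_poly f (He F n.+1) = He K n.+1 by case.
  elim: n => [|n [IH IHS]]; first by rewrite !H0 !H1 rmorph1 map_polyX.
  split=> //; rewrite !HeSS rmorphB rmorphM /= map_polyX IHS.
  by rewrite map_polyZ IH rmorph_nat.
rewrite /heS map_polyZ fmorphV; congr (_^-1 *: _).
  by rewrite -!altdet_ffact /altdet -det_map_mx; congr (\det _);
     apply/matrixP => i j; rewrite !mxE rmorph_nat.
rewrite /heW /altdet -[RHS]det_map_mx; congr (\det _).
by apply/matrixP => i j; rewrite !mxE /= -derivn_map fHe.
Qed.

Lemma HeP_Phi (F : numFieldType) (mu nu : seq nat) (k : nat) :
  is_partition mu -> is_partition nu ->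
  HeP F (Phi mu nu k) =
  heS F (interlace (shift_maya (size nu) (degs mu)) (degs nu) (size mu + k)).
Proof.
by move=> pm pn; rewrite HeP_heS degs_of_maya; apply/heS_perm/perm_PhiMaya.
Qed.

Lemma coef_Rpoly (F : fieldType) lam c i : (Rpoly F lam c)`_i = (HeP F lam)`_(c + 2 * i).
Proof.
rewrite coef_poly; case: ltnP => // h; rewrite nth_default //.
by apply: leq_trans h _; lia.
Qed.

(* Uniform convergence on compact subsets of C with rate O(1/k):
   compact subsets of C are exactly the subsets of closed discs |x| <= r. *)
Theorem theorem5p1 (R : realType) (mu nu : seq nat) :
  is_partition mu -> is_partition nu ->
  forall r : R, exists Cst : R, exists k0 : nat,
    forall k : nat, (k0 <= k)%N ->
    forall x : R[i], `|x| <= r%:C ->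
      `| (RPhi R[i] mu nu k).[(2 * k)%:R * x] / ((2 * k)%:R ^+ (psize mu + psize nu))
         - (x + 1) ^+ psize mu * (x - 1) ^+ psize nu |
      <= (Cst / k%:R)%:C.
Proof.
move=> pm pn r.
(* These runners do not depend on [k]; only the odd run, of length [size mu + k], grows. *)
pose a := shift_maya (size nu) (degs mu); pose b := degs nu.
have ua : uniq a by rewrite shift_maya_uniq // degs_uniq.
have ub : uniq b by apply: degs_uniq.
have ea : excess a = psize mu by rewrite excess_shift_maya excess_degs.
have eb : excess b = psize nu by rewrite excess_degs.
have sab : (size mu + size b = size a)%N by rewrite size_shift_maya !size_degs addnC.
set N := (psize mu + psize nu)%N.
pose g i k : R := scaled_coef R a b (size mu) i k.
pose l i : R := (limit_poly R (psize mu) (psize nu))`_i.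
have gl i : rate_cvg (g i) (l i).
  by rewrite /l -ea -eb; apply: rate_cvg_scaled_coef.
(* This finite sum of [O(1/k)] terms bounds the error on the whole disc, hence one constant for all
   [x]. *)
have [c [k0 [_ h]]] : rate_cvg (fun k => \sum_(i < N.+1) `|g i k - l i| * `|r| ^+ i) 0.
  rewrite [X in rate_cvg _ X](_ : 0 = \sum_(i < N.+1) 0 * `|r| ^+ i); last first.
    by rewrite big1 // => i _; rewrite mul0r.
  apply: (@rate_cvg_sum _ _ _ (fun (i : 'I_N.+1) k => `|g i k - l i| * `|r| ^+ i)
    (fun i => 0 * `|r| ^+ i)) => i _.
  apply: rate_cvgM (rate_cvg_cst _).
  have [c [k0 [c0 h]]] := gl i; exists c, k0; split=> // k hk.
  by rewrite subr0 normr_id h.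
exists c, k0.+1 => k hk x xr.
have k1 : (0 < k)%N by apply: leq_ltn_trans hk.
have kC : (2 * k)%:R != 0 :> R[i] by rewrite pnatr_eq0; lia.
have -> : (RPhi R[i] mu nu k).[(2 * k)%:R * x] / (2 * k)%:R ^+ N =
    \sum_(i < N.+1) (g i k)%:C * x ^+ i.
  have cR i : (RPhi R[i] mu nu k)`_i =
      ((heS R (interlace a b (size mu + k)))`_('C(k.+1, 2) + 2 * i))%:C.
    by rewrite coef_Rpoly HeP_Phi // (map_heS _ _ (real_complex R)) coef_map.
  (* Coefficients beyond degree [N] vanish, so the number of terms is independent of [k]. *)
  rewrite (@horner_coef_wide _ N.+1); last first.
    apply/leq_sizeP => j hj; rewrite cR.
    by rewrite coef_heS_interlace_gt // ea eb.
  rewrite mulr_suml; apply: eq_bigr => i _; rewrite cR /g /scaled_coef ea eb -/N.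
  have k2 : (2 * k%:R)%:C = (2 * k)%:R :> R[i] by rewrite rmorphM !rmorph_nat -natrM.
  rewrite 2!rmorphM /= fmorphV !rmorphXn /= k2 exprMn.
  by rewrite !mulrA mulrAC.
have -> : (x + 1) ^+ psize mu * (x - 1) ^+ psize nu = \sum_(i < N.+1) (l i)%:C * x ^+ i.
  have [_ sz] := limit_poly_monic R (psize mu) (psize nu).
  have -> : (x + 1) ^+ psize mu * (x - 1) ^+ psize nu =
      (map_poly (real_complex R) (limit_poly R (psize mu) (psize nu))).[x].
    by rewrite /limit_poly rmorphM !rmorphXn rmorphD rmorphB /= !map_polyX !rmorph1 !hornerE.
  rewrite (@horner_coef_wide _ N.+1) ?size_map_poly ?sz //.
  by apply: eq_bigr => i _; rewrite coef_map.
rewrite -sumrB; apply: le_trans (ler_norm_sum _ _ _) _.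
apply: (@le_trans _ _ ((\sum_(i < N.+1) `|g i k - l i| * `|r| ^+ i)%:C)).
  rewrite rmorph_sum; apply: ler_sum => i _.
  rewrite -mulrBl normrM normrX [X in _ <= X]rmorphM [X in _ <= _ * X]rmorphXn -rmorphB /=.
  have nC (z : R) : `|z%:C| = `|z|%:C by rewrite normc_def /= expr0n addr0 sqrtr_sqr.
  rewrite nC; apply: ler_wpM2l; first by rewrite ler0c.
  apply: lerXn2r; rewrite ?nnegrE ?normr_ge0 //; first by rewrite ler0c.
  by apply: (le_trans xr); rewrite lecR ler_norm.
rewrite lecR; apply: le_trans (h _ hk); rewrite subr0; exact: ler_norm.
Qed.
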